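(* Let $n\geq 1$ be an integer and let $V=\mathbb{C}[x_1,\ldots,x_n]\otimes\mathbb{C}^{1|2n}$ be the tensor product $\mathfrak{osp}(1|2n)$-module, with $\lambda$-weight spaces $V_\lambda$. Then there exist automorphisms ${}^{w_1}\Gamma$ and ${}^{w_2}\Gamma$ of the super vector space $V$ such that the following hold. (a) The image of $\mathbb{C}[x_1,\ldots,x_n]\otimes\mathbb{C}^{1|0}$ under ${}^{w_2}\Gamma$ has the structure of an $\mathfrak{osp}(1|2n)$-module (it is an $\mathfrak{osp}(1|2n)$-submodule of $V$). (b) The image of $\mathbb{C}[x_1,\ldots,x_n]\otimes\mathbb{C}^{0|2n}$ under ${}^{w_1}\Gamma$ has the structure of an $\mathfrak{osp}(1|2n)$-module (it is an $\mathfrak{osp}(1|2n)$-submodule of $V$). (c) For every weight $\lambda$ of $V$, the restriction ${}^{w_1}\Gamma_\lambda$ of ${}^{w_1}\Gamma$ to $V_\lambda$ is an automorphism of $V_\lambda$. Furthermore, ${}^{w_1}\Gamma_\lambda$ can be expressed as a block within an infinite diagonal block matrix of invertible arrowhead matrices (the matrix of ${}^{w_1}\Gamma$ with respect to the weight basis $\bigcup_\lambda\mathcal{B}_\lambda$ of $V$). (d) For every weight $\lambda$ of $V$, the restriction ${}^{w_2}\Gamma_\lambda$ of ${}^{w_2}\Gamma$ to $V_\lambda$ is an automorphism of $V_\lambda$. Furthermore, ${}^{w_2}\Gamma_\lambda$ can be expressed as a block within an infinite diagonal block matrix of invertible arrowhead matrices (the matrix of ${}^{w_2}\Gamma$ with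 respect to the weight basis $\bigcup_\lambda\mathcal{B}_\lambda$ of $V$).
   Context: All vector spaces are over $\mathbb{C}$; $|\cdot|$ denotes parity in $\mathbb{Z}/2\mathbb{Z}$. $\mathbb{C}^{1|2n}$ has homogeneous basis $v_0$ (even), $v_1,\ldots,v_{2n}$ (odd); $\mathbb{C}^{1|0}=\mathbb{C}v_0$ and $\mathbb{C}^{0|2n}=\bigoplus_{i=1}^{2n}\mathbb{C}v_i$. The Lie superalgebra $\mathfrak{osp}(1|2n)\subset\mathfrak{gl}(1|2n)$ consists of the block matrices $\begin{bmatrix}0&r\\c&A\end{bmatrix}$ with $r=(r_1,\ldots,r_{2n})$, $c^{\intercal}=(r_{n+1},\ldots,r_{2n},-r_1,\ldots,-r_n)$, $A\in\mathfrak{sp}(2n)$, with the supercommutator bracket; $A$ gives the even part and $(r,c)$ the odd part. The inclusion is the natural representation $\tau$ on $\mathbb{C}^{1|2n}$. As a Lie superalgebra it is generated by the odd root vectors $X_{\pm j}=X_{\pm\delta_j}$ ($1\le j\le n$, $\delta_j$ the $j$-th standard basis vector of $\mathbb{C}^n$), where $T_{\pm j}=\tau(X_{\pm j})$ acts by $T_jv_0=v_j$, $T_jv_{n+j}=v_0$, $T_{-j}v_0=-v_{n+j}$, $T_{-j}v_j=v_0$, and zero on all other basis vectors. The oscillator (completely-pointed) representation $\rho$ on $\mathbb{C}[x_1,\ldots,x_n]$ (parity of a monomial = its total degree mod 2) is determined by $\rho(X_j)=\tfrac1{\sqrt2}x_j$, $\rho(X_{-j})=\tfrac1{\sqrt2}\partial/\partial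 x_j$. The tensor product representation $\rho\otimes\tau$ on $V$ is $X(f\otimes v)=\rho(X)f\otimes v+(-1)^{|X||f|}f\otimes\tau(X)v$ for homogeneous $X,f$. Weights: the Cartan subalgebra is spanned by $H_{2\delta_j}=[X_j,X_{-j}]$, $1\le j\le n$; a vector has weight $\lambda=(\lambda_1,\ldots,\lambda_n)$ if $H_{2\delta_j}$ acts on it by $\lambda_j$ for all $j$. With $\mathbf{x}^{\mathbf{k}}=x_1^{k_1}\cdots x_n^{k_n}$, the vector $\mathbf{x}^{\mathbf{k}}\otimes v_i$ has weight $\mathbf{k}+\tfrac12(1,\ldots,1)+\mathrm{wt}(v_i)$, where $\mathrm{wt}(v_0)=0$, $\mathrm{wt}(v_j)=\delta_j$, $\mathrm{wt}(v_{n+j})=-\delta_j$ for $1\le j\le n$. $\mathcal{B}_\lambda$ denotes the basis of $V_\lambda$ consisting of the elementary tensors $\mathbf{x}^{\mathbf{k}}\otimes v_i$ of weight $\lambda$, ordered with the one of the form $\mathbf{x}^{\mathbf{k}}\otimes v_0$ (if present) first. An arrowhead matrix is a square matrix whose entries are all zero except possibly those in the first row, the first column and on the main diagonal ($1\times1$ matrices included). *)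

(* Defs.v *)
From HB Require Import structures.
From mathcomp Require Import all_boot all_order all_algebra.
From mathcomp Require Import mpoly ring.

Set Implicit Arguments.
Unset Strict Implicit.
Unset Printing Implicit Defensive.

Import GRing.Theory Num.Theory.
Local Open Scope ring_scope.

(* C^{1|2n} is the space of column vectors 'cV[C]_(1 + (n + n)), with basis
   v_i = vb i: izero, ipos j and ineg j (for 0 <= j < n) are the indices of
   v_0, v_{j+1} and v_{n+j+1} in the usual 1-based numbering. *)
Definition izero n : 'I_(1 + (n + n)) := lshift (n + n) ord0.
Definition ipos n (j : 'I_n) : 'I_(1 + (n + n)) := rshift 1 (lshift n j).
Definition ineg n (j : 'I_n) : 'I_(1 + (n + n)) := rshift 1 (rshift n j).
Definition vpar n (i : 'I_(1 + (n + n))) : bool := i != izero n.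

Section Osp.
Variables (C : numClosedFieldType) (n : nat).
Local Notation mx := 'M[C]_(1 + (n + n)).

Definition vb (i : 'I_(1 + (n + n))) : 'cV[C]_(1 + (n + n)) := delta_mx i 0.

(* Parity is a boolean: false is even, true is odd. *)
Definition mxpart (p : bool) (X : mx) : mx :=
  if p then block_mx 0 (ursubmx X) (dlsubmx X) 0
  else block_mx (ulsubmx X) 0 0 (drsubmx X).
Definition mxpar (p : bool) (X : mx) : Prop := mxpart p X = X.

(* The supercommutator of X of parity p and Y of parity q. *)
Definition sbracket (p q : bool) (X Y : mx) : mx :=
  X *m Y - (-1) ^+ (p && q) *: (Y *m X).

Definition sympJ : 'M[C]_(n + n) := block_mx 0 1%:M (- 1%:M) 0.
Definition sp (A : 'M[C]_(n + n)) : Prop := A^T *m sympJ + sympJ *m A = 0.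

Definition osp_col (r : 'rV[C]_(n + n)) : 'cV[C]_(n + n) :=
  (row_mx (rsubmx r) (- lsubmx r))^T.
Definition osp (X : mx) : Prop :=
  exists (r : 'rV[C]_(n + n)) (A : 'M[C]_(n + n)),
    sp A /\ X = block_mx 0 r (osp_col r) A.

Definition Xpos (j : 'I_n) : mx :=
  delta_mx (ipos j) (izero n) + delta_mx (izero n) (ineg j).
Definition Xneg (j : 'I_n) : mx :=
  delta_mx (izero n) (ipos j) - delta_mx (ineg j) (izero n).
Definition Hdelta (j : 'I_n) : mx := sbracket true true (Xpos j) (Xneg j).

(* Representations of osp(1|2n) on a super vector space U, whose homogeneous
   vectors of parity p are given by par p. The value of a representation
   outside osp is irrelevant. *)
Definition osp_rep (U : lmodType C) (par : bool -> U -> Prop)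
    (pi : mx -> U -> U) : Prop :=
  [/\ forall X, osp X -> forall a u v, pi X (a *: u + v) = a *: pi X u + pi X v,
      forall a X Y, osp X -> osp Y ->
        forall u, pi (a *: X + Y) u = a *: pi X u + pi Y u,
      forall p q X u, osp X -> mxpar p X -> par q u -> par (p (+) q) (pi X u)
    & forall p q X Y, osp X -> osp Y -> mxpar p X -> mxpar q Y ->
        forall u, pi (sbracket p q X Y) u
                  = pi X (pi Y u) - (-1) ^+ (p && q) *: pi Y (pi X u)].

Definition polypar (p : bool) (f : {mpoly C[n]}) : Prop :=
  forall m, f@_m != 0 -> odd (mdeg m) = p.

(* Such a rho exists (osc_oscillator below), and it is unique on osp because
   the Xpos j and Xneg j generate osp(1|2n). *)
Definition is_oscillator (rho : mx -> {mpoly C[n]} -> {mpoly C[n]}) : Prop :=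
  [/\ osp_rep polypar rho,
      forall j f, rho (Xpos j) f = (sqrtC 2)^-1 *: ('X_j * f)
    & forall j f, rho (Xneg j) f = (sqrtC 2)^-1 *: f^`M(j)].

(* C[x_1, .., x_n] (x) C^{1|2n}: u stands for the sum of the u i (x) v_i. *)
Local Notation V := {ffun 'I_(1 + (n + n)) -> {mpoly C[n]}}.

Definition tens (f : {mpoly C[n]}) (v : 'cV[C]_(1 + (n + n))) : V :=
  [ffun i => v i 0 *: f].

Definition Vpar (p : bool) (u : V) : Prop :=
  forall i, polypar (p (+) vpar i) (u i).

(* f(-x), that is (-1)^|f| f when f is homogeneous. *)
Definition psign (f : {mpoly C[n]}) : {mpoly C[n]} :=
  f \mPo [tuple - 'X_i | i < n].

(* The tensor product of rho and the natural representation, extended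
   linearly from the formula on elementary tensors proved in tact_tens. *)
Definition tact (rho : mx -> {mpoly C[n]} -> {mpoly C[n]}) (X : mx) (u : V) : V :=
  [ffun i => rho X (u i) + \sum_k mxpart false X i k *: u k
                         + \sum_k mxpart true X i k *: psign (u k)].

Variable rho : mx -> {mpoly C[n]} -> {mpoly C[n]}.

(* Submodules are graded, as usual for super vector spaces. *)
Definition osp_submodule (W : V -> Prop) : Prop :=
  [/\ W 0,
      forall a u v, W u -> W v -> W (a *: u + v),
      forall u, W u ->
        exists u0 u1, [/\ W u0, W u1, Vpar false u0, Vpar true u1 & u = u0 + u1]
    & forall X u, osp X -> W u -> W (tact rho X u)].

Definition V10 (u : V) : Prop := forall i, vpar i -> u i = 0.
Definition V02n (u : V) : Prop := u (izero n) = 0.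
Definition image_of (G : V -> V) (W : V -> Prop) (w : V) : Prop :=
  exists2 u, W u & w = G u.

Definition super_automorphism (G : {linear V -> V}) : Prop :=
  bijective G /\ forall p u, Vpar p u -> Vpar p (G u).

Definition weight_space (lam : 'I_n -> C) (u : V) : Prop :=
  forall j, tact rho (Hdelta j) u = lam j *: u.
Definition is_weight (lam : 'I_n -> C) : Prop :=
  exists2 u, weight_space lam u & u != 0.

(* a = (k, i) indexes the elementary tensor x^k (x) v_i; these form the
   basis of V that is the union of the B_lambda. *)
Definition btens (a : 'X_{1..n} * 'I_(1 + (n + n))) : V :=
  tens 'X_[a.1] (vb a.2).

(* s is the list of the elements of B_lambda, the one with i = 0 (if any)
   coming first, in an otherwise arbitrary order. *)
Definition ordered_basis (lam : 'I_n -> C)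
    (s : seq ('X_{1..n} * 'I_(1 + (n + n)))) : Prop :=
  [/\ uniq s,
      forall a, a \in s <-> weight_space lam (btens a)
    & forall a, a \in s -> a.2 = izero n -> index a s = 0%N].

(* Entry (a, b) of the matrix of G in the basis btens: the coordinate of
   G (btens b) along btens a. *)
Definition matrix_of (G : V -> V) (a b : 'X_{1..n} * 'I_(1 + (n + n))) : C :=
  (G (btens b) a.2)@_(a.1).

Definition matrix_block (G : V -> V) (s : seq ('X_{1..n} * 'I_(1 + (n + n)))) :
    'M[C]_(size s) :=
  \matrix_(i, j) matrix_of G (tnth (in_tuple s) i) (tnth (in_tuple s) j).

Definition arrowhead d (A : 'M[C]_d) : Prop :=
  forall i j : 'I_d,
    i != 0%N :> nat -> j != 0%N :> nat -> i != j -> A i j = 0.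

Definition restricts_to_automorphism (G : V -> V) (lam : 'I_n -> C) : Prop :=
  (forall u, weight_space lam u -> weight_space lam (G u)) /\
  (forall w, weight_space lam w -> exists! u, weight_space lam u /\ G u = w).

Definition block_diagonal (G : V -> V) : Prop :=
  forall lam a b, weight_space lam (btens b) ->
    matrix_of G a b != 0 -> weight_space lam (btens a).

Definition invertible_arrowhead_block (G : V -> V) (lam : 'I_n -> C) : Prop :=
  (exists s, ordered_basis lam s) /\
  (forall s, ordered_basis lam s ->
     arrowhead (matrix_block G s) /\ matrix_block G s \in unitmx).

Lemma Xpos_vb j : [/\ Xpos j *m vb (izero n) = vb (ipos j),
  Xpos j *m vb (ineg j) = vb (izero n)
  & forall i, i != izero n -> i != ineg j -> Xpos j *m vb i = 0].
Proof.
split=> [||i i0 ij]; rewrite /Xpos /vb mulmxDl.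
- by rewrite mul_delta_mx mul_delta_mx_0 ?addr0 // eq_sym.
- by rewrite mul_delta_mx mul_delta_mx_0 ?add0r.
- by rewrite !mul_delta_mx_0 ?addr0 // eq_sym.
Qed.

Lemma Xneg_vb j : [/\ Xneg j *m vb (izero n) = - vb (ineg j),
  Xneg j *m vb (ipos j) = vb (izero n)
  & forall i, i != izero n -> i != ipos j -> Xneg j *m vb i = 0].
Proof.
split=> [||i i0 ij]; rewrite /Xneg /vb mulmxBl.
- by rewrite mul_delta_mx mul_delta_mx_0 ?sub0r // eq_sym.
- by rewrite mul_delta_mx mul_delta_mx_0 ?subr0.
- by rewrite !mul_delta_mx_0 ?subr0 // eq_sym.
Qed.

Lemma osp_col_rshift j :
  osp_col (delta_mx 0 (rshift n j)) = delta_mx (lshift n j) 0.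
Proof.
rewrite /osp_col delta_mx_rshift row_mxKl row_mxKr oppr0 tr_row_mx.
by rewrite trmx0 trmx_delta delta_mx_ushift.
Qed.

Lemma osp_col_lshift j :
  osp_col (delta_mx 0 (lshift n j)) = - delta_mx (rshift n j) 0.
Proof.
rewrite /osp_col delta_mx_lshift row_mxKl row_mxKr tr_row_mx.
by rewrite trmx0 linearN /= trmx_delta delta_mx_dshift opp_col_mx oppr0.
Qed.

Lemma delta_row (k : 'I_(n + n)) :
  delta_mx (izero n) (rshift 1 k) = block_mx 0 (delta_mx 0 k) 0 0 :> mx.
Proof. by rewrite delta_mx_ushift delta_mx_rshift /block_mx row_mx0. Qed.

Lemma delta_col (k : 'I_(n + n)) :
  delta_mx (rshift 1 k) (izero n) = block_mx 0 0 (delta_mx k 0) 0 :> mx.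
Proof. by rewrite delta_mx_dshift delta_mx_lshift /block_mx row_mx0. Qed.

Lemma Xpos_block j : Xpos j =
  block_mx 0 (delta_mx 0 (rshift n j)) (osp_col (delta_mx 0 (rshift n j))) 0.
Proof.
rewrite /Xpos osp_col_rshift /ipos /ineg delta_row delta_col.
by rewrite add_block_mx !addr0 !add0r.
Qed.

Lemma Xneg_block j : Xneg j =
  block_mx 0 (delta_mx 0 (lshift n j)) (osp_col (delta_mx 0 (lshift n j))) 0.
Proof.
rewrite /Xneg osp_col_lshift /ipos /ineg delta_row delta_col.
by rewrite opp_block_mx add_block_mx !oppr0 !addr0 !add0r.
Qed.

Lemma Xpos_osp j : osp (Xpos j) /\ mxpar true (Xpos j).
Proof.
split.
  exists (delta_mx 0 (rshift n j)), 0; split; last exact: Xpos_block.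
  by rewrite /sp trmx0 mul0mx mulmx0 addr0.
by rewrite /mxpar /= Xpos_block block_mxKur block_mxKdl.
Qed.

Lemma Xneg_osp j : osp (Xneg j) /\ mxpar true (Xneg j).
Proof.
split.
  exists (delta_mx 0 (lshift n j)), 0; split; last exact: Xneg_block.
  by rewrite /sp trmx0 mul0mx mulmx0 addr0.
by rewrite /mxpar /= Xneg_block block_mxKur block_mxKdl.
Qed.

Lemma psign_par p f : polypar p f -> psign f = (-1) ^+ p *: f.
Proof.
move=> hf; rewrite [f in RHS]mpolyE /psign comp_mpolyEX scaler_sumr.
apply: eq_big_seq => m; rewrite mcoeff_msupp => /hf <-.
rewrite comp_mpolyX scalerA mulrC -scalerA; congr (_ *: _).
rewrite signr_odd mdegE -prodrXr mpolyXE_id -scaler_prod.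
by apply: eq_bigr => i _; rewrite tnth_mktuple -scaleN1r exprZn.
Qed.

Lemma mxpart_id p X : mxpar p X -> mxpart (~~ p) X = 0.
Proof.
by rewrite /mxpar; case: p => /= <-; rewrite ?(block_mxKur, block_mxKdl,
  block_mxKul, block_mxKdr) block_mx0.
Qed.

Lemma tact_tens p q X f v : linear (rho X) -> mxpar p X -> polypar q f ->
  tact rho X (tens f v) = tens (rho X f) v + (-1) ^+ (p && q) *: tens f (X *m v).
Proof.
move=> lX pX qf; apply/ffunP => i; rewrite !ffunE -addrA; congr (_ + _).
  have z : rho X 0 = 0.
    by have := lX 1 0 0; rewrite !scale1r addr0 -{1}[rho X 0]addr0 => /addrI.
  by rewrite -[v i 0 *: f]addr0 lX z addr0.
have pN := mxpart_id pX; rewrite /mxpar in pX.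
rewrite [(X *m v) i 0]mxE scaler_suml scaler_sumr -big_split.
apply: eq_bigr => k _; rewrite !ffunE; case: p pX pN => pX.
  rewrite [mxpart (~~ true) X]/(mxpart false X) => ->; rewrite pX.
  rewrite [(0 : mx) i k]mxE scale0r /= add0r /psign comp_mpolyZ -/(psign f) (psign_par qf).
  by rewrite !scalerA mulrC [X i k * _]mulrC mulrA.
rewrite [mxpart (~~ false) X]/(mxpart true X) => ->; rewrite pX.
by rewrite [(0 : mx) i k]mxE scale0r /= addr0 scale1r scalerA.
Qed.

Lemma btens_basis (u : V) :
  u = \sum_i \sum_(m <- msupp (u i)) (u i)@_m *: btens (m, i).
Proof.
apply/ffunP => k; rewrite sum_ffunE (bigD1 k) //=.
rewrite [X in _ = _ + X]big1 ?addr0 => [|i ik]; rewrite sum_ffunE.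
  rewrite [LHS]mpolyE; apply: eq_bigr => m _.
  by rewrite !ffunE mxE !eqxx scale1r.
rewrite big1 // => m _.
by rewrite !ffunE mxE eq_sym (negPf ik) scale0r scaler0.
Qed.

End Osp.

Section OscillatorExists.
Variables (C : numClosedFieldType) (n : nat).
Local Notation mx := 'M[C]_(1 + (n + n)).
Local Notation P := {mpoly C[n]}.

Let c : C := (sqrtC 2)^-1.

Lemma osc_c2 : c * c = 2^-1.
Proof. by rewrite /c -invfM -expr2 sqrtCK. Qed.

(* oscD k is the image of the odd matrix with r = delta_mx 0 k, oscB i that
   of the odd matrix with column delta_mx i 0. *)
Definition oscD (k : 'I_(n + n)) (f : P) : P :=
  match split k with inl j => c *: f^`M(j) | inr j => c *: ('X_j * f) end.
Definition oscB (k : 'I_(n + n)) (f : P) : P :=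
  match split k with inl j => c *: ('X_j * f) | inr j => - c *: f^`M(j) end.
Definition oscL (r : 'rV[C]_(n + n)) (f : P) : P := \sum_i r 0 i *: oscD i f.
Definition oscE (A : 'M[C]_(n + n)) (f : P) : P :=
  \sum_i \sum_k A i k *: oscB i (oscD k f).
Definition osc (X : mx) (f : P) : P :=
  oscL (ursubmx X) f + oscE (drsubmx X) f.

Lemma oscD_linear k : linear (oscD k).
Proof.
move=> a u v; rewrite /oscD; case: split => j.
  by rewrite linearP scalerDr !scalerA mulrC.
by rewrite mulrDr scalerDr -scalerAr !scalerA mulrC.
Qed.

Lemma oscB_linear k : linear (oscB k).
Proof.
move=> a u v; rewrite /oscB; case: split => j.
  by rewrite mulrDr scalerDr -scalerAr !scalerA mulrC.
by rewrite linearP scalerDr !scalerA mulrC.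
Qed.

HB.instance Definition _ k := GRing.isLinear.Build C P P *:%R (oscD k) (oscD_linear k).
HB.instance Definition _ k := GRing.isLinear.Build C P P *:%R (oscB k) (oscB_linear k).

Lemma oscL_linear r : linear (oscL r).
Proof.
move=> a u v; rewrite scaler_sumr -big_split; apply: eq_bigr => i _ /=.
by rewrite linearP scalerDr !scalerA mulrC.
Qed.
HB.instance Definition _ r := GRing.isLinear.Build C P P *:%R (oscL r) (oscL_linear r).

Lemma oscE_linear A : linear (oscE A).
Proof.
move=> a u v; rewrite scaler_sumr -big_split; apply: eq_bigr => i _ /=.
rewrite scaler_sumr -big_split; apply: eq_bigr => k _ /=.
by rewrite !linearP.
Qed.
HB.instance Definition _ A := GRing.isLinear.Build C P P *:%R (oscE A) (oscE_linear A).

Lemma oscLP a r s f : oscL (a *: r + s) f = a *: oscL r f + oscL s f.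
Proof.
rewrite scaler_sumr -big_split; apply: eq_bigr => i _ /=.
by rewrite !mxE scalerDl scalerA.
Qed.

Lemma oscEP a A B f : oscE (a *: A + B) f = a *: oscE A f + oscE B f.
Proof.
rewrite scaler_sumr -big_split; apply: eq_bigr => i _ /=.
rewrite scaler_sumr -big_split; apply: eq_bigr => k _ /=.
by rewrite !mxE scalerDl scalerA.
Qed.

Lemma oscL_delta k f : oscL (delta_mx 0 k) f = oscD k f.
Proof.
rewrite /oscL (bigD1 k) //= big1 ?addr0 ?mxE ?eqxx ?scale1r // => i ik.
by rewrite mxE (negPf ik) andbF scale0r.
Qed.

Lemma oscLB r f : oscL r f = \sum_i osp_col r i 0 *: oscB i f.
Proof.
rewrite /oscL !big_split_ord /= addrC; congr (_ + _); apply: eq_bigr => j _.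
  rewrite /oscD /oscB -/(unsplit (inr j)) -/(unsplit (inl j)) !unsplitK.
  by rewrite !mxE -/(unsplit (inl j)) unsplitK !mxE.
rewrite /oscD /oscB -/(unsplit (inr j)) -/(unsplit (inl j)) !unsplitK.
by rewrite !mxE -/(unsplit (inr j)) unsplitK !mxE !scalerA mulrNN.
Qed.

Lemma mderivXU (j l : 'I_n) : ('X_l : P)^`M(j) = (j == l)%:R.
Proof.
rewrite mderivX mnm1E eq_sym; case: eqP => [->|_]; last by rewrite scale0r.
by rewrite scale1r -{1}[U_(l)%MM]addm0 addmC addmK mpolyX0.
Qed.

Lemma oscDB k i f :
  oscD k (oscB i f) = oscB i (oscD k f) + ((k == i)%:R / 2) *: f.
Proof.
rewrite -[k]splitK -[i]splitK /oscD /oscB !unsplitK.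
case: (split k) (split i) => [j|j] [l|l] /=.
- rewrite eq_lshift !linearZ /= mderivM mderivXU scalerDr scalerDr addrC.
  congr (_ + _); first by rewrite -scalerAr.
  rewrite scalerA osc_c2; case: eqP => _; first by rewrite !mul1r.
  by rewrite !mul0r scaler0 scale0r.
- rewrite eq_lrshift mul0r scale0r addr0 !linearZ /= !scalerA mulrC.
  by rewrite mderiv_comm.
- rewrite eq_rlshift mul0r scale0r addr0 -!scalerAr !scalerA.
  by rewrite !mulrA ['X_j * _]mulrC.
- rewrite eq_rshift !linearZ /= mderivM mderivXU -!scalerAr !scalerA.
  rewrite [l == j]eq_sym mulrN osc_c2 scalerDr addrAC -[LHS]add0r.
  congr (_ + _); case: eqP => _; last by rewrite !mul0r scaler0 scale0r addr0.
  by rewrite !mul1r -scalerDl addNr scale0r.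
Qed.

Lemma oscDL k r f :
  oscD k (oscL r f) = oscL r (oscD k f) + (osp_col r k 0 / 2) *: f.
Proof.
rewrite !oscLB linear_sum /= (eq_bigr (fun i => osp_col r i 0 *: oscB i (oscD k f)
  + (osp_col r i 0 * ((k == i)%:R / 2)) *: f)); last first.
  by move=> i _; rewrite linearZ /= oscDB scalerDr scalerA.
rewrite big_split /=; congr (_ + _); rewrite (bigD1 k) //= big1 ?addr0.
  by rewrite eqxx mul1r.
by move=> i ik; rewrite eq_sym (negPf ik) mul0r mulr0 scale0r.
Qed.

Lemma oscLBcomm i r f :
  oscL r (oscB i f) = oscB i (oscL r f) + (r 0 i / 2) *: f.
Proof.
rewrite linear_sum /= /oscL (eq_bigr (fun k => r 0 k *: oscB i (oscD k f)
  + (r 0 k * ((k == i)%:R / 2)) *: f)); last first.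
  by move=> k _; rewrite oscDB scalerDr scalerA.
rewrite big_split /=; congr (_ + _).
  by apply: eq_bigr => k _; rewrite linearZ.
rewrite (bigD1 i) //= big1 ?addr0 ?eqxx ?mul1r // => k ki.
by rewrite (negPf ki) mul0r mulr0 scale0r.
Qed.

Lemma osp_colE (r : 'rV[C]_(n + n)) : osp_col r = sympJ C n *m r^T.
Proof.
rewrite /osp_col /sympJ -{3}[r]hsubmxK !tr_row_mx mul_block_col !mul0mx mul1mx.
by rewrite add0r addr0 mulNmx mul1mx linearN.
Qed.

Lemma sympJJ : sympJ C n *m sympJ C n = - 1%:M.
Proof.
rewrite /sympJ mulmx_block !mul0mx !mulmx0 !mul1mx !mulNmx !mul1mx.
by rewrite !add0r !addr0 scalar_mx_block opp_block_mx oppr0.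
Qed.

Lemma sp_col (A : 'M[C]_(n + n)) r : sp A -> osp_col (- (r *m A)) = A *m osp_col r.
Proof.
move=> hA; rewrite !osp_colE linearN /= trmx_mul mulmxN mulmxA mulmxA -mulNmx.
congr (_ *m _).
move/eqP: hA; rewrite addr_eq0 => /eqP hA.
transitivity (sympJ C n *m (A^T *m sympJ C n) *m sympJ C n).
  by rewrite -!mulmxA sympJJ !mulmxN !mulmx1.
by rewrite hA mulmxN mulNmx mulmxA sympJJ !mulNmx mul1mx opprK.
Qed.

Lemma oscLN r f : oscL (- r) f = - oscL r f.
Proof.
rewrite /oscL -sumrN; apply: eq_bigr => i _.
by rewrite mxE scaleNr.
Qed.

Lemma oscEL A r f : sp A ->
  oscE A (oscL r f) = oscL r (oscE A f) + oscL (- (r *m A)) f.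
Proof.
move=> hA.
have h i g : oscB i (oscL r g) = oscL r (oscB i g) - (r 0 i / 2) *: g.
  by rewrite oscLBcomm addrK.
have e i k : A i k *: oscB i (oscD k (oscL r f))
  = oscL r (A i k *: oscB i (oscD k f))
    - 2^-1 *: ((r 0 i * A i k) *: oscD k f)
    + 2^-1 *: ((A i k * osp_col r k 0) *: oscB i f).
  rewrite oscDL linearD /= !linearZ /= h !(scalerDr, scalerN) !scalerA.
  by congr (_ - _ *: _ + _ *: _); ring.
transitivity (oscL r (oscE A f) - 2^-1 *: oscL (r *m A) f
    + 2^-1 *: \sum_i (A *m osp_col r) i 0 *: oscB i f).
  rewrite [oscL (r *m A) f](_ : _ =
      \sum_i \sum_k (r 0 i * A i k) *: oscD k f); last first.
    rewrite exchange_big; apply: eq_bigr => k _ /=.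
    by rewrite mxE scaler_suml.
  rewrite [oscE A f in RHS]/oscE [oscL r (\sum_i _)]linear_sum.
  rewrite !scaler_sumr -sumrB -big_split.
  apply: eq_bigr => i _ /=.
  rewrite [oscL r (\sum_k _)]linear_sum mxE scaler_suml.
  rewrite !scaler_sumr -sumrB -big_split.
  by apply: eq_bigr => k _ /=; rewrite e.
rewrite -sp_col // -oscLB oscLN scalerN -addrA -opprD -scalerDl.
by rewrite -[2^-1]mul1r -splitr scale1r.
Qed.

Lemma oscED A k f : sp A ->
  oscE A (oscD k f) = oscD k (oscE A f) - \sum_l A k l *: oscD l f.
Proof.
move=> hA; rewrite -!oscL_delta oscEL // oscLN; congr (_ - _).
by apply: eq_bigr => l _; rewrite -rowE mxE.
Qed.

Lemma oscEB A i f : sp A ->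
  oscE A (oscB i f) = oscB i (oscE A f) + \sum_l A l i *: oscB l f.
Proof.
move=> hA; pose r : 'rV[C]_(n + n) := - (sympJ C n *m delta_mx i 0)^T.
have rB : osp_col r = delta_mx i 0.
  by rewrite osp_colE /r linearN /= trmxK mulmxN mulmxA sympJJ mulNmx mul1mx opprK.
have LB g : oscL r g = oscB i g.
  rewrite oscLB rB (bigD1 i) //= big1 ?addr0 ?mxE ?eqxx ?scale1r // => l li.
  by rewrite mxE (negPf li) scale0r.
rewrite -!LB oscEL //; congr (_ + _); rewrite oscLB sp_col // rB.
by apply: eq_bigr => l _; rewrite -colE mxE.
Qed.

Lemma oscEE A B f : sp A ->
  oscE A (oscE B f) = oscE B (oscE A f) + oscE (A *m B - B *m A) f.
Proof.
move=> hA.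
have e i k : oscE A (B i k *: oscB i (oscD k f)) = B i k *: oscB i (oscD k (oscE A f))
   + (\sum_l (A l i * B i k) *: oscB l (oscD k f)
      - \sum_l (B i k * A k l) *: oscB i (oscD l f)).
  rewrite linearZ /= oscEB // oscED // linearB /= linear_sum /= -addrA scalerDr.
  congr (_ + _); rewrite addrC scalerBr !scaler_sumr; congr (_ - _).
    by apply: eq_bigr => l _; rewrite scalerA mulrC.
  rewrite [oscB i (\sum_l _)]linear_sum scaler_sumr.
  by apply: eq_bigr => l _; rewrite linearZ /= scalerA.
rewrite [oscE B f]/oscE [LHS]linear_sum.
rewrite (eq_bigr (fun i => \sum_k (B i k *: oscB i (oscD k (oscE A f))
   + (\sum_l (A l i * B i k) *: oscB l (oscD k f)
      - \sum_l (B i k * A k l) *: oscB i (oscD l f))))); last first.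
  by move=> i _; rewrite /= [LHS]linear_sum; apply: eq_bigr => k _; exact: e.
under eq_bigr do rewrite big_split /=.
rewrite big_split /=; congr (_ + _).
rewrite [oscE _ f](_ : _ = oscE (A *m B) f - oscE (B *m A) f); last first.
  by rewrite -[A *m B - _]addrC -scaleN1r oscEP scaleN1r addrC.
under eq_bigr do rewrite sumrB.
rewrite sumrB; congr (_ - _).
  under eq_bigr do rewrite exchange_big.
  rewrite exchange_big; apply: eq_bigr => l _; rewrite exchange_big.
  by apply: eq_bigr => k _; rewrite mxE scaler_suml.
rewrite /oscE; apply: eq_bigr => i _; rewrite exchange_big /=.
by apply: eq_bigr => l _; rewrite mxE scaler_suml.
Qed.

Lemma oscLL r s f :
  oscE (osp_col r *m s + osp_col s *m r) f = oscL r (oscL s f) + oscL s (oscL r f).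
Proof.
rewrite -[osp_col r *m s]scale1r oscEP scale1r.
have h (u v : 'rV[C]_(n + n)) : oscE (osp_col u *m v) f = oscL u (oscL v f).
  rewrite [RHS]oscLB; apply: eq_bigr => i _.
  rewrite linear_sum scaler_sumr; apply: eq_bigr => k _.
  by rewrite mxE big_ord1 linearZ scalerA.
by rewrite !h.
Qed.

Lemma polyparZ q a (f : P) : polypar q f -> polypar q (a *: f).
Proof.
by move=> hf m; rewrite mcoeffZ mulf_eq0 negb_or => /andP[_ /hf].
Qed.

Lemma polyparD q (f g : P) : polypar q f -> polypar q g -> polypar q (f + g).
Proof.
move=> hf hg m; rewrite mcoeffD; have [->|/hf //] := eqVneq f@_m 0.
by rewrite add0r => /hg.
Qed.

Lemma polypar0 q : polypar q (0 : P).
Proof. by move=> m; rewrite mcoeff0 eqxx. Qed.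

Lemma polypar_sum q (I : finType) (F : I -> P) :
  (forall i, polypar q (F i)) -> polypar q (\sum_i F i).
Proof.
by move=> h; elim/big_rec: _ => [|i g _]; [exact: polypar0 | exact: polyparD].
Qed.

Lemma polyparX q j (f : P) : polypar q f -> polypar (~~ q) ('X_j * f).
Proof.
move=> hf m; rewrite -mcoeff_msupp mulrC (perm_mem (msuppMX _ _)).
case/mapP => m' m'f ->; rewrite mdegD mdeg1 add1n /=; congr (~~ _).
by apply: hf; rewrite -mcoeff_msupp.
Qed.

Lemma polypar_deriv q j (f : P) : polypar q f -> polypar (~~ q) f^`M(j).
Proof.
move=> hf m; rewrite mcoeff_mderiv mulrn_eq0 negb_or => /andP[_ /hf <-].
by rewrite mdegD mdeg1 addn1 negbK.
Qed.

Lemma oscD_par q k f : polypar q f -> polypar (~~ q) (oscD k f).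
Proof.
move=> hf; rewrite /oscD; case: split => j; apply: polyparZ;
  by [exact: polypar_deriv | exact: polyparX].
Qed.

Lemma oscB_par q k f : polypar q f -> polypar (~~ q) (oscB k f).
Proof.
move=> hf; rewrite /oscB; case: split => j; apply: polyparZ;
  by [exact: polypar_deriv | exact: polyparX].
Qed.

Lemma oscL_par q r f : polypar q f -> polypar (~~ q) (oscL r f).
Proof. by move=> hf; apply: polypar_sum => i; apply/polyparZ/oscD_par. Qed.

Lemma oscE_par q A f : polypar q f -> polypar q (oscE A f).
Proof.
move=> hf; apply: polypar_sum => i; apply: polypar_sum => k; apply: polyparZ.
by rewrite -[q]negbK; apply/oscB_par/oscD_par.
Qed.

Lemma oscE0 f : oscE 0 f = 0.
Proof.
by apply: big1 => i _; apply: big1 => k _; rewrite mxE scale0r.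
Qed.

Lemma oscL0 f : oscL 0 f = 0.
Proof. by apply: big1 => i _; rewrite mxE scale0r. Qed.

Lemma osc_block a r s A f : osc (block_mx a r s A) f = oscL r f + oscE A f.
Proof. by rewrite /osc block_mxKur block_mxKdr. Qed.

Lemma osp_homog p (X : mx) : osp X -> mxpar p X ->
  if p then exists r, X = block_mx 0 r (osp_col r) 0
  else exists2 A, sp A & X = block_mx 0 0 0 A.
Proof.
case=> r [A [hA ->]]; rewrite /mxpar; case: p => /=;
  rewrite ?(block_mxKul, block_mxKur, block_mxKdl, block_mxKdr) => e.
  by exists r; rewrite -e.
by exists A; rewrite // -e.
Qed.

Lemma osc_rep : osp_rep (@polypar C n) osc.
Proof.
split.
- by move=> X _ a u v; rewrite /osc !linearP scalerDr addrACA.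
- move=> a X Y _ _ f; rewrite /osc.
  have -> : ursubmx (a *: X + Y) = a *: ursubmx X + ursubmx Y.
    by apply/matrixP => i j; rewrite !mxE.
  have -> : drsubmx (a *: X + Y) = a *: drsubmx X + drsubmx Y.
    by apply/matrixP => i j; rewrite !mxE.
  by rewrite oscLP oscEP scalerDr addrACA.
- move=> p q X f hX hp hf; have := osp_homog hX hp; case: p {hp} => [[r ->]|[A hA ->]].
    by rewrite osc_block oscE0 addr0; apply: oscL_par.
  by rewrite osc_block oscL0 add0r; apply: oscE_par.
- move=> p q X Y hX hY hp hq f.
  have := osp_homog hX hp; have := osp_homog hY hq.
  case: q {hq hY} => [[s ->]|[B hB ->]]; case: p {hp hX} => [[r ->]|[A hA ->]];
  rewrite /sbracket /= ?expr1 ?expr0 ?scaleN1r ?scale1r ?opprK !mulmx_block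
    !mul0mx !mulmx0 !addr0 ?opp_block_mx ?oppr0 add_block_mx ?addr0 ?add0r
    !osc_block ?oscE0 ?oscL0 ?addr0 ?add0r.
  + exact: oscLL.
  + by rewrite oscEL // addrAC subrr add0r.
  + by rewrite oscEL // opprD addrA subrr sub0r oscLN opprK.
  + by rewrite oscEE // addrAC subrr add0r.
Qed.

Lemma osc_oscillator : is_oscillator osc.
Proof.
split; first exact: osc_rep.
- move=> j f; rewrite Xpos_block osc_block oscE0 addr0 oscL_delta /oscD.
  by rewrite -/(unsplit (inr j)) unsplitK.
- move=> j f; rewrite Xneg_block osc_block oscE0 addr0 oscL_delta /oscD.
  by rewrite -/(unsplit (inl j)) unsplitK.
Qed.

End OscillatorExists.

(* Main.v *)
(* Write s for f(x) |-> f(-x). On odd matrices rho is a combination of the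
   operators x_j and d_j = d/dx_j. By their canonical commutation relations,
     f |-> s f (x) v_0 + sqrt 2 sum_j (d_j f (x) v_j + x_j f (x) v_(n+j))
   intertwines rho with rho (x) tau, and dually
     u |-> s u_0 - sqrt 2 sum_j s (x_j s u_j - d_j s u_(n+j))
   intertwines rho (x) tau with rho. The image of the first and the kernel of
   the second are submodules, and they are graphs of linear maps between
   C[x] (x) C^{1|0} and C[x] (x) C^{0|2n}. So they are the images of these two
   spaces under shears id + N with N^2 = 0, where N preserves weights and either
   only maps the v_0-part to the others or only maps the others to the
   v_0-part: on a weight space, id + N is a triangular arrowhead matrix with
   diagonal 1. *)
Require Import Defs.
From HB Require Import structures.
From mathcomp Require Import all_boot all_order all_algebra.
From mathcomp Require Import mpoly complex reals ring.

Set Implicit Arguments.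
Unset Strict Implicit.
Unset Printing Implicit Defensive.

Import GRing.Theory Num.Theory.
Local Open Scope ring_scope.

(** * The grading sign on polynomials, and the odd elements that generate osp(1|2n) *)

Section Superspace.
Variables (C : numClosedFieldType) (n : nat).
Local Notation P := {mpoly C[n]}.
Local Notation V := {ffun 'I_(1 + (n + n)) -> P}.
Local Notation mx := 'M[C]_(1 + (n + n)).

Lemma psign_linear : linear (@psign C n).
Proof. by move=> a f g; rewrite /psign linearP. Qed.
HB.instance Definition _ :=
  GRing.isLinear.Build C P P *:%R (@psign C n) psign_linear.

Lemma polyparXm m : polypar (odd (mdeg m)) ('X_[m] : P).
Proof.
by move=> k; rewrite mcoeffX; have [->|] := eqVneq m k; rewrite ?eqxx.
Qed.

Lemma mcoeff_psign (f : P) m : (psign f)@_m = (-1) ^+ odd (mdeg m) * f@_m.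
Proof.
rewrite {1}[f]mpolyE [psign _]linear_sum /= raddf_sum /= (eq_bigr (fun k =>
  (-1) ^+ odd (mdeg m) * (f@_k *: 'X_[k])@_m)); last first.
  move=> k _; rewrite linearZ /= (psign_par (@polyparXm k)) !mcoeffZ mcoeffX.
  by have [->|_] := eqVneq k m; rewrite ?mulr0 // mulrCA.
by rewrite -mulr_sumr -raddf_sum /= -mpolyE.
Qed.

Lemma psignK : involutive (@psign C n).
Proof.
move=> f; apply/mpolyP => m.
by rewrite !mcoeff_psign mulrA -signr_addb addbb mul1r.
Qed.

Lemma polypar_psign q (f : P) : polypar q f -> polypar q (psign f).
Proof.
by move=> hf m; rewrite mcoeff_psign mulf_eq0 negb_or => /andP[_ /hf].
Qed.

(** By linearity it is enough to look at monomials. These are homogeneous, so [psign] acts on each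
    by a sign, and [T] reverses that sign. *)
Lemma psign_odd (T : {linear P -> P}) :
    (forall q f, polypar q f -> polypar (~~ q) (T f)) ->
  forall f, psign (T f) = - T (psign f).
Proof.
move=> oddT f; rewrite [f]mpolyE [T _]linear_sum [psign _]linear_sum.
rewrite [psign (\sum_(i <- _) _)]linear_sum [T (\sum_(i <- _) _)]linear_sum /=.
rewrite -sumrN.
apply: eq_bigr => m _; rewrite [psign (_ *: 'X_[_])]linearZ !linearZ /=.
congr (_ *: _).
rewrite (psign_par (@polyparXm m)) (psign_par (oddT _ _ (@polyparXm m))).
by rewrite linearZ -scaleNr /=; case: odd; rewrite /= ?expr1 ?expr0 ?opprK.
Qed.

Lemma psign_oscL r (f : P) : psign (oscL r f) = - oscL r (psign f).
Proof. exact: (@psign_odd (oscL r) (fun q f => @oscL_par C n q r f)). Qed.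

Lemma psign_oscD k (f : P) : psign (oscD k f) = - oscD k (psign f).
Proof. exact: (@psign_odd (oscD k) (fun q f => @oscD_par C n q k f)). Qed.

Lemma psign_oscB k (f : P) : psign (oscB k f) = - oscB k (psign f).
Proof. exact: (@psign_odd (oscB k) (fun q f => @oscB_par C n q k f)). Qed.

(** By [osp_homog], every odd element of osp(1|2n) has this form. *)
Definition oddmx (r : 'rV[C]_(n + n)) : mx := block_mx 0 r (osp_col r) 0.

Lemma osp_colP a (r s : 'rV[C]_(n + n)) :
  osp_col (a *: r + s) = a *: osp_col r + osp_col s.
Proof. by rewrite !osp_colE linearP mulmxDr scalemxAr. Qed.

Lemma oddmxP a r s : oddmx (a *: r + s) = a *: oddmx r + oddmx s.
Proof.
by rewrite /oddmx scale_block_mx add_block_mx !scaler0 !addr0 osp_colP.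
Qed.

Lemma oddmx0 : oddmx 0 = 0.
Proof. by have := oddmxP (-1) 0 0; rewrite scaler0 addr0 scaleN1r addNr. Qed.

Lemma oddmx_osp r : osp (oddmx r).
Proof.
by exists r, 0; split=> //; rewrite /sp trmx0 mul0mx mulmx0 addr0.
Qed.

Lemma oddmx_par r : mxpar true (oddmx r).
Proof. by rewrite /mxpar /= block_mxKur block_mxKdl. Qed.

Lemma tr_sympJ : (sympJ C n)^T = - sympJ C n.
Proof.
rewrite /sympJ tr_block_mx !trmx0 linearN /= trmx1 opp_block_mx !oppr0.
by rewrite opprK.
Qed.

(** The product is the symplectic form of [r] and [s]. A 1x1 matrix equals its transpose, so the
    antisymmetry of [sympJ] gives the sign. *)
Lemma row_osp_col (r s : 'rV[C]_(n + n)) : r *m osp_col s = - (s *m osp_col r).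
Proof.
rewrite [LHS]mx11_scalar -tr_scalar_mx -mx11_scalar !osp_colE !trmx_mul.
rewrite trmxK tr_sympJ.
by rewrite mulmxN mulNmx mulmxA.
Qed.

(** The scalar corner is the symplectic form symmetrized in [r] and [s], which vanishes by
    [row_osp_col]. *)
Lemma sbracket_oddmx r s : sbracket true true (oddmx r) (oddmx s) =
  block_mx 0 0 0 (sympJ C n *m (r^T *m s + s^T *m r)).
Proof.
rewrite /sbracket expr1 scaleN1r opprK !mulmx_block !mul0mx !mulmx0.
rewrite !addr0 !add0r add_block_mx !addr0 row_osp_col addNr !osp_colE.
by rewrite -!mulmxA -mulmxDr.
Qed.

(** Since [sympJ] squares to -1, this and [sp_sym] identify sp(2n) with the symmetric matrices
    through multiplication by [sympJ]. *)
Lemma sp_sympJ (S : 'M[C]_(n + n)) : S^T = S -> sp (sympJ C n *m S).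
Proof.
move=> symS; rewrite /sp trmx_mul symS tr_sympJ -mulmxA mulNmx mulmxA sympJJ.
by rewrite opprK mulmx1 mulNmx mul1mx subrr.
Qed.

Lemma sp_sym (A : 'M[C]_(n + n)) : sp A -> (sympJ C n *m A)^T = sympJ C n *m A.
Proof.
move=> spA; apply/eqP; rewrite trmx_mul tr_sympJ mulmxN eq_sym -addr_eq0 addrC.
exact/eqP.
Qed.

Lemma sbracket_oddmx_osp r s : osp (sbracket true true (oddmx r) (oddmx s)).
Proof.
rewrite sbracket_oddmx; exists 0, (sympJ C n *m (r^T *m s + s^T *m r)); split.
  by apply: sp_sympJ; rewrite linearD /= !trmx_mul !trmxK addrC.
by rewrite osp_colE trmx0 mulmx0.
Qed.

Lemma osp_linear a (X Y : mx) : osp X -> osp Y -> osp (a *: X + Y).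
Proof.
case=> r [A [spA ->]] [s [B [spB ->]]]; exists (a *: r + s), (a *: A + B).
split; last by rewrite scale_block_mx add_block_mx scaler0 addr0 osp_colP.
rewrite /sp linearP /= mulmxDl mulmxDr -scalemxAl -scalemxAr addrACA -scalerDr.
by rewrite spA spB scaler0 addr0.
Qed.

(* With [J] the matrix [sympJ], a matrix [A] of [sp] is [- J S] with [S = J A]
   symmetric, and summing the brackets of the k-th unit vector with the k-th
   row of [S] gives [J (S + S^T)]. *)
Lemma osp_ind (Q : mx -> Prop) :
    (forall a X Y, osp X -> osp Y -> Q X -> Q Y -> Q (a *: X + Y)) ->
    (forall r, Q (oddmx r)) ->
    (forall r s, Q (sbracket true true (oddmx r) (oddmx s))) ->
  forall X, osp X -> Q X.
Proof.
move=> Qlin Qodd Qeven X [r [A [spA ->]]].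
pose S := sympJ C n *m A.
pose Br k := sbracket true true (oddmx (delta_mx 0 k)) (oddmx (row k S)).
have sumB : \sum_k Br k = block_mx 0 0 0 (- 2 *: A).
  rewrite (eq_bigr (fun k => block_mx 0 0 0
    (sympJ C n *m (delta_mx k 0 *m row k S + (row k S)^T *m delta_mx 0 k)))).
    have bigblock I (l : seq I) (F : I -> 'M[C]_(n + n)) :
        \sum_(k <- l) (block_mx 0 0 0 (F k) : mx) =
        block_mx 0 0 0 (\sum_(k <- l) F k).
      elim/big_rec2: _ => [|k B1 B2 _ ->]; first by rewrite block_mx0.
      by rewrite add_block_mx !addr0.
    rewrite bigblock -mulmx_sumr big_split /=; congr (block_mx _ _ _ _).
    have sumS : \sum_k delta_mx k 0 *m row k S = S.
      under eq_bigr do rewrite rowE mulmxA mul_delta_mx.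
      by rewrite -mulmx_suml -mx1_sum_delta mul1mx.
    have -> : \sum_k (row k S)^T *m delta_mx 0 k = S^T.
      rewrite -[in RHS]sumS linear_sum; apply: eq_bigr => k _ /=.
      by rewrite trmx_mul trmx_delta.
    rewrite sumS (sp_sym spA) -mulr2n -scaler_nat -scalemxAr mulmxA sympJJ.
    by rewrite mulNmx mul1mx scalerN scaleNr.
  by move=> k _; rewrite /Br sbracket_oddmx trmx_delta.
have -> : block_mx 0 r (osp_col r) A = - 2^-1 *: \sum_k Br k + oddmx r.
  rewrite sumB scale_block_mx !scaler0 scalerA mulrNN mulVf ?pnatr_eq0 //.
  by rewrite scale1r add_block_mx !add0r addr0.
have Q0 : Q 0 by rewrite -oddmx0; apply: Qodd.
have osp0 : osp (0 : mx) by rewrite -oddmx0; apply: oddmx_osp.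
have [ospB QB] : osp (\sum_k Br k) /\ Q (\sum_k Br k).
  elim/big_rec: _ => [//|k Y _ [ospY QY]]; rewrite -[Br k]scale1r; split.
    by apply: osp_linear => //; exact: sbracket_oddmx_osp.
  by apply: Qlin => //; [exact: sbracket_oddmx_osp | exact: Qeven].
by apply: Qlin => //; exact: oddmx_osp.
Qed.

End Superspace.

(** * The tensor product action on odd generators, graded submodules, and weights *)

Section TensorProduct.
Variables (C : numClosedFieldType) (n : nat).
Local Notation P := {mpoly C[n]}.
Local Notation V := {ffun 'I_(1 + (n + n)) -> P}.
Local Notation mx := 'M[C]_(1 + (n + n)).
Variables (rho : mx -> P -> P) (hrho : is_oscillator rho).

Lemma rho_linear a (X Y : mx) f :
  osp X -> osp Y -> rho (a *: X + Y) f = a *: rho X f + rho Y f.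
Proof. by move=> ospX ospY; case: hrho => -[_ lin _ _] _ _; exact: lin. Qed.

Lemma rho0 f : rho 0 f = 0.
Proof.
have osp0 : osp (0 : mx) by rewrite -oddmx0; exact: oddmx_osp.
have := rho_linear (-1) f osp0 osp0.
by rewrite scaler0 addr0 scaleN1r addNr.
Qed.

(** The defining formulas fix [rho] on the matrices with a unit row, which are the [Xneg j] and
    [Xpos j]. Linearity carries this to every row. *)
Lemma rho_oddmx r f : rho (oddmx r) f = oscL r f.
Proof.
have rho_delta k : rho (oddmx (delta_mx 0 k)) f = oscD k f.
  case: hrho => _ rhoX rhoD; rewrite -[k]splitK /oscD unsplitK /oddmx.
  by case: split => j /=; rewrite -?Xneg_block -?Xpos_block ?rhoX ?rhoD.
rewrite [r in LHS]row_sum_delta /oscL.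
elim/big_rec2: _ => [|k f1 r1 _ IH]; first by rewrite oddmx0 rho0.
by rewrite oddmxP (rho_linear _ _ (oddmx_osp _) (oddmx_osp _)) rho_delta IH.
Qed.

Lemma tact_linear a (X Y : mx) u : osp X -> osp Y ->
  tact rho (a *: X + Y) u = a *: tact rho X u + tact rho Y u.
Proof.
move=> ospX ospY; apply/ffunP => i; rewrite !ffunE rho_linear //.
have mxpartP p : mxpart p (a *: X + Y) = a *: mxpart p X + mxpart p Y.
  rewrite /mxpart; case: p; rewrite scale_block_mx add_block_mx !scaler0 !addr0;
    by congr (block_mx _ _ _ _); apply/matrixP => k l; rewrite !mxE.
rewrite !scalerDr addrACA; congr (_ + _); [rewrite addrACA; congr (_ + _) |];
  rewrite scaler_sumr -big_split; apply: eq_bigr => k _;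
  by rewrite mxpartP 2!mxE scalerDl -scalerA.
Qed.

Lemma tact_oddmx r u i :
  tact rho (oddmx r) u i = oscL r (u i) + \sum_k oddmx r i k *: psign (u k).
Proof.
have even0 := mxpart_id (oddmx_par r); have odd1 := oddmx_par r.
rewrite !ffunE rho_oddmx [mxpart false _]even0 odd1; congr (_ + _).
by rewrite big1 ?addr0 // => k _; rewrite mxE scale0r.
Qed.

Lemma tact_oddmx_zero r u : tact rho (oddmx r) u (izero n) =
  oscL r (u (izero n)) + \sum_k r 0 k *: psign (u (rshift 1 k)).
Proof.
rewrite tact_oddmx big_split_ord /= big_ord1 block_mxEul mxE scale0r add0r.
by congr (_ + _); apply: eq_bigr => k _; rewrite block_mxEur.
Qed.

Lemma tact_oddmx_rshift r u k : tact rho (oddmx r) u (rshift 1 k) =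
  oscL r (u (rshift 1 k)) + osp_col r k 0 *: psign (u (izero n)).
Proof.
rewrite tact_oddmx big_split_ord /= big_ord1 block_mxEdl.
rewrite [X in _ + (_ + X)]big1 ?addr0 // => l _.
by rewrite block_mxEdr mxE scale0r.
Qed.

Lemma tact_sbracketE r s u i :
  tact rho (sbracket true true (oddmx r) (oddmx s)) u i =
  oscL r (oscL s (u i)) + oscL s (oscL r (u i)) +
  \sum_k sbracket true true (oddmx r) (oddmx s) i k *: u k.
Proof.
rewrite !ffunE -addrA; congr (_ + _).
  case: hrho => -[_ _ _ rhoB] _ _.
  rewrite rhoB ?expr1 ?scaleN1r ?opprK; try exact: oddmx_osp;
    try exact: oddmx_par.
  by rewrite !rho_oddmx.
rewrite sbracket_oddmx /mxpart block_mxKul block_mxKdr block_mxKur block_mxKdl.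
by rewrite block_mx0 [X in _ + X]big1 ?addr0 // => k _; rewrite mxE scale0r.
Qed.

(** The action respects brackets of odd elements because [psign] anticommutes with [oscL] and is an
    involution. *)
Lemma tact_sbracket r s u :
  tact rho (sbracket true true (oddmx r) (oddmx s)) u =
  tact rho (oddmx r) (tact rho (oddmx s) u) +
  tact rho (oddmx s) (tact rho (oddmx r) u).
Proof.
apply/ffunP => i; rewrite tact_sbracketE ffunE.
(* The last parenthesis collects the terms mixing the two tensor factors. It changes sign when [r1]
   and [s1] are exchanged, so it drops out of the anticommutator. *)
have comp r1 s1 : tact rho (oddmx r1) (tact rho (oddmx s1) u) i =
    oscL r1 (oscL s1 (u i)) + \sum_k (oddmx r1 *m oddmx s1) i k *: u k
    + (\sum_k oddmx s1 i k *: oscL r1 (psign (u k))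
       - \sum_k oddmx r1 i k *: oscL s1 (psign (u k))).
  rewrite tact_oddmx tact_oddmx linearD /= -!addrA.
  congr (_ + _); rewrite [RHS]addrCA; congr (_ + _).
    by rewrite [LHS]linear_sum; apply: eq_bigr => k _; rewrite linearZ.
  rewrite -sumrN [X in _ = X + _](eq_bigr (fun k =>
    \sum_l (oddmx r1 i l * oddmx s1 l k) *: u k)); last first.
    by move=> k _; rewrite mxE scaler_suml.
  rewrite exchange_big -big_split; apply: eq_bigr => k _ /=.
  rewrite tact_oddmx [psign _]linearD /= psign_oscL.
  rewrite [psign (\sum_(k <- _) _)]linear_sum.
  rewrite scalerDr scalerN addrC; congr (_ + _); rewrite scaler_sumr.
  by apply: eq_bigr => l _; rewrite linearZ /= psignK scalerA.
have cancel_cross (a b c d x y : P) :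
    a + b + (x - y) + (c + d + (y - x)) = a + c + (b + d) by ring.
apply: etrans (esym (congr2 +%R (comp r s) (comp s r))); rewrite cancel_cross.
congr (_ + _); rewrite -big_split; apply: eq_bigr => k _ /=.
by rewrite /sbracket expr1 scaleN1r opprK mxE scalerDl.
Qed.

(** The grading involution of V: it multiplies vectors of parity [p] by the sign of [p]. *)
Definition parity_op (u : V) : V := [ffun i => (-1) ^+ vpar i *: psign (u i)].

(** Stability under the grading involution gives the homogeneous components as half of the vector
    plus or minus its image. Stability under odd elements extends to brackets by [tact_sbracket],
    hence to all of osp(1|2n) by [osp_ind]. *)
Lemma osp_submoduleP (W : V -> Prop) :
    W 0 -> (forall a u v, W u -> W v -> W (a *: u + v)) ->
    (forall u, W u -> W (parity_op u)) ->
    (forall r u, W u -> W (tact rho (oddmx r) u)) ->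
  osp_submodule rho W.
Proof.
move=> W0 Wlin Wpar Wodd; split=> //.
- have WZ a u : W u -> W (a *: u).
    by move=> Wu; rewrite -[_ *: _]addr0; apply: Wlin.
  have par_half p u : Vpar p (2^-1 *: ((-1) ^+ p *: parity_op u + u)).
    move=> i m; rewrite !ffunE scalerA -signr_addb mcoeffZ mcoeffD mcoeffZ.
    rewrite mcoeff_psign mulrA -signr_addb -[X in _ + X]mul1r -mulrDl => nz.
    apply/eqP; move: nz; apply: contraR => ne.
    suff -> : p (+) vpar i (+) odd (mdeg m) = true.
      by rewrite expr1 addNr mul0r mulr0.
    by move: ne; case: (p (+) vpar i) (odd (mdeg m)) => -[].
  move=> u Wu; exists (2^-1 *: ((-1) ^+ false *: parity_op u + u)).
  exists (2^-1 *: ((-1) ^+ true *: parity_op u + u)).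
  split; try exact: par_half.
  + by apply/WZ/Wlin => //; exact: Wpar.
  + by apply/WZ/Wlin => //; exact: Wpar.
  rewrite expr0 expr1 scale1r scaleN1r -scalerDr addrACA subrr add0r.
  by rewrite -mulr2n -scaler_nat scalerA mulVf ?scale1r ?pnatr_eq0.
- move=> X u ospX; elim/osp_ind: X / ospX u
    => [a X Y ospX ospY IHX IHY u Wu|r u|r s u Wu].
  + by rewrite tact_linear //; apply: Wlin; [exact: IHX | exact: IHY].
  + exact: Wodd.
  + rewrite tact_sbracket -[X in W (X + _)]scale1r.
    by apply: Wlin; apply: (Wodd _ _ (Wodd _ _ Wu)).
Qed.

Definition wt (i : 'I_(1 + (n + n))) (l : 'I_n) : C :=
  (i == ipos l)%:R - (i == ineg l)%:R.

Lemma Hdelta_diag (l : 'I_n) : Hdelta C l =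
  delta_mx (ipos l) (ipos l) - delta_mx (ineg l) (ineg l).
Proof.
rewrite /Hdelta /sbracket expr1 scaleN1r opprK /Xpos /Xneg.
rewrite !(mulmxDl, mulmxDr, mulmxBl, mulmxBr, mulmxN, mulNmx).
rewrite !mul_delta_mx_cond.
rewrite !eqxx /ipos /ineg /izero !eq_lrshift !eq_rlshift.
rewrite !mulr0n !mulr1n !oppr0 !addr0 !add0r.
by rewrite addrA subrK.
Qed.

(** On polynomials the anticommutator is half of x_l d_l + d_l x_l, that is, x_l d_l + 1/2. On the
    second factor [Hdelta] is diagonal with entries [wt]. *)
Lemma tact_Hdelta (l : 'I_n) u i m :
  (tact rho (Hdelta C l) u i)@_m = ((m l)%:R + 2^-1 + wt i l) * (u i)@_m.
Proof.
have HE : Hdelta C l = sbracket true true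
    (oddmx (delta_mx 0 (rshift n l))) (oddmx (delta_mx 0 (lshift n l))).
  by rewrite /oddmx -Xpos_block -Xneg_block.
rewrite HE tact_sbracketE -HE Hdelta_diag.
rewrite (bigD1 i) //= big1 => [|k ki]; last first.
  have offdiag p : (delta_mx p p : mx) i k = 0.
    by rewrite mxE; case: eqP => //= <-; rewrite (negPf ki).
  by rewrite mxE offdiag mxE offdiag subrr scale0r.
have -> :
    (delta_mx (ipos l) (ipos l) - delta_mx (ineg l) (ineg l)) i i = wt i l.
  by rewrite !mxE !andbb.
rewrite !oscL_delta /oscD -/(unsplit (inl l)) -/(unsplit (inr l)) !unsplitK.
rewrite !linearZ /= -!scalerAr !scalerA osc_c2 mderivM mderivXU eqxx mul1r.
rewrite addr0 mcoeffD mcoeffD !mcoeffZ mcoeffD.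
(* The Euler operator is diagonal on monomials. Its eigenvalue comes from that of d_l x_l by
   subtracting 1, which avoids treating exponent 0 separately. *)
have -> : ('X_l * (u i)^`M(l))@_m = (m l)%:R * (u i)@_m.
  have : (('X_l * u i)^`M(l))@_m = (m l).+1%:R * (u i)@_m.
    by rewrite mcoeff_mderiv addmC mulrC mcoeffMX mulr_natl.
  rewrite mderivM mderivXU eqxx mul1r mcoeffD addrC -natr1 mulrDl mul1r.
  exact: addIr.
rewrite [RHS]mulrDl; congr (_ + _).
by field.
Qed.

(** The Cartan elements act diagonally on elementary tensors, so being a weight vector is a
    condition on the support alone. *)
Lemma weight_spaceP lam u : weight_space rho lam u <->
  forall i m, (u i)@_m != 0 -> forall l, (m l)%:R + 2^-1 + wt i l = lam l.
Proof.
split=> [wu i m nz l|wu l].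
  have /ffunP/(_ i)/(congr1 (mcoeff m)) := wu l.
  by rewrite tact_Hdelta ffunE mcoeffZ => /(mulIf nz).
apply/ffunP => i; apply/mpolyP => m; rewrite tact_Hdelta ffunE mcoeffZ.
by have [->|/wu->] := eqVneq (u i)@_m 0; rewrite ?mulr0.
Qed.

Lemma mcoeff_btens a i m : (btens C a i)@_m = (a == (m, i) :> 'X_{1..n} * _)%:R.
Proof.
rewrite ffunE mxE andbT mcoeffZ mcoeffX; case: a => k j /=.
by rewrite xpair_eqE andbC [i == j]eq_sym -natrM mulnb.
Qed.

Lemma weight_btens lam (a : 'X_{1..n} * 'I_(1 + (n + n))) :
  weight_space rho lam (btens C a) <->
  forall l, (a.1 l)%:R + 2^-1 + wt a.2 l = lam l.
Proof.
split=> [/weight_spaceP wa l|wa].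
  by apply: wa; rewrite mcoeff_btens -surjective_pairing eqxx oner_neq0.
apply/weight_spaceP => i m; rewrite mcoeff_btens.
have [ea _ l|_] := eqVneq a (m, i); last by rewrite eqxx.
by rewrite -wa ea.
Qed.

End TensorProduct.

(** * Bases of weight spaces, and shears by a square-zero map *)

Section Shear.
Variables (C : numClosedFieldType) (n : nat).
Local Notation P := {mpoly C[n]}.
Local Notation idx := 'I_(1 + (n + n)).
Local Notation V := {ffun idx -> P}.
Local Notation mx := 'M[C]_(1 + (n + n)).
Variables (rho : mx -> P -> P) (hrho : is_oscillator rho).

Lemma rshift_neq_izero (k : 'I_(n + n)) : (rshift 1 k == izero n) = false.
Proof. exact: eq_rlshift. Qed.

Lemma idx_ind (Q : idx -> Prop) :
  Q (izero n) -> (forall k, Q (rshift 1 k)) -> forall i, Q i.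
Proof.
move=> Q0 Qk i; rewrite -(splitK i).
case: (split i) => [k|k] /=; last exact: Qk.
by rewrite [k]ord1.
Qed.

Lemma wt_izero (l : 'I_n) : wt C (izero n) l = 0.
Proof. by rewrite /wt /izero /ipos /ineg !eq_lrshift subrr. Qed.

Lemma wt_ipos (j l : 'I_n) : wt C (ipos j) l = (j == l)%:R.
Proof. by rewrite /wt /ipos /ineg !eq_rshift eq_lshift eq_lrshift subr0. Qed.

Lemma wt_ineg (j l : 'I_n) : wt C (ineg j) l = - (j == l)%:R.
Proof. by rewrite /wt /ipos /ineg !eq_rshift eq_rlshift sub0r. Qed.

Lemma mcoeff_mulX_neq0 (f : P) j m : ('X_j * f)@_m != 0 ->
  exists2 m', f@_m' != 0 & forall l, (m l)%:R = (m' l)%:R + (j == l)%:R :> C.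
Proof.
rewrite -mcoeff_msupp mulrC (perm_mem (msuppMX _ _)) => /mapP[m' m'f ->].
by exists m' => [|l]; rewrite -?mcoeff_msupp // mnmDE mnm1E natrD addrC.
Qed.

Lemma mcoeff_mderiv_neq0 (f : P) j m : (f^`M(j))@_m != 0 ->
  exists2 m', f@_m' != 0 & forall l, (m' l)%:R = (m l)%:R + (j == l)%:R :> C.
Proof.
rewrite mcoeff_mderiv mulrn_eq0 negb_or => /andP[_ nz].
by exists (m + U_(j))%MM => // l; rewrite mnmDE mnm1E natrD.
Qed.

(** [oscD k] lowers the weight by that of the matching odd basis vector, so sending f (x) v_0 to
    [oscD k f] tensored with that vector preserves weights. [oscB k] is the opposite shift. *)
Lemma mcoeff_oscD_neq0 k (f : P) m : (oscD k f)@_m != 0 ->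
  exists2 m', f@_m' != 0
            & forall l, (m l)%:R + wt C (rshift 1 k) l = (m' l)%:R.
Proof.
rewrite -[k]splitK /oscD unsplitK.
case: (split k) => j /=; rewrite mcoeffZ mulf_eq0 negb_or => /andP[_].
  case/mcoeff_mderiv_neq0 => m' nz mE; exists m' => // l.
  by rewrite (wt_ipos j) mE.
case/mcoeff_mulX_neq0 => m' nz mE; exists m' => // l.
by rewrite (wt_ineg j) mE addrK.
Qed.

Lemma mcoeff_oscB_neq0 k (f : P) m : (oscB k f)@_m != 0 ->
  exists2 m', f@_m' != 0
            & forall l, (m' l)%:R + wt C (rshift 1 k) l = (m l)%:R.
Proof.
rewrite -[k]splitK /oscB unsplitK.
case: (split k) => j /=; rewrite mcoeffZ mulf_eq0 negb_or => /andP[_].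
  case/mcoeff_mulX_neq0 => m' nz mE; exists m' => // l.
  by rewrite (wt_ipos j) mE.
case/mcoeff_mderiv_neq0 => m' nz mE; exists m' => // l.
by rewrite (wt_ineg j) mE addrK.
Qed.

Lemma weight_spaceD lam u v : weight_space rho lam u ->
  weight_space rho lam v -> weight_space rho lam (u + v).
Proof.
move=> /(weight_spaceP hrho) wu /(weight_spaceP hrho) wv.
apply/(weight_spaceP hrho) => i m; rewrite ffunE mcoeffD.
by have [->|/wu//] := eqVneq (u i)@_m 0; rewrite add0r => /wv.
Qed.

Lemma weight_spaceN lam u :
  weight_space rho lam u -> weight_space rho lam (- u).
Proof.
move=> /(weight_spaceP hrho) wu; apply/(weight_spaceP hrho) => i m.
by rewrite ffunE mcoeffN oppr_eq0 => /wu.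
Qed.

(** In particular, a weight space contains at most one basis tensor with second factor v_0. *)
Lemma weight_basis_inj lam (a b : 'X_{1..n} * idx) :
  weight_space rho lam (btens C a) -> weight_space rho lam (btens C b) ->
  a.2 = b.2 -> a = b.
Proof.
move=> /(weight_btens hrho) wa /(weight_btens hrho) wb eq2.
rewrite [a]surjective_pairing [b]surjective_pairing eq2; congr pair.
apply/mnmP => l; have := wa l; rewrite -(wb l) eq2 => /addIr/addIr/eqP.
by rewrite eqr_nat => /eqP.
Qed.

Lemma ordered_basis_exists lam :
  is_weight rho lam -> exists s, ordered_basis rho lam s.
Proof.
case=> u /(weight_spaceP hrho) wu nzu.
have [i0 [m0 nz]] : exists i m, (u i)@_m != 0.
  have /existsP[i nzi] : [exists i, u i != 0].
    rewrite -negb_forall; apply: contra nzu => /forallP u0.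
    by apply/eqP/ffunP => i; rewrite ffunE; apply/eqP/u0.
  by exists i, (mlead (u i)); rewrite mleadc_eq0.
have lamE := wu _ _ nz.
(* The coordinates of [wt] lie in {-1, 0, 1}, so basis tensors of equal weight have exponents
   differing by at most 2 in each variable. The successor makes the degree bound strict, as bounded
   multinomials require, and leaves a finite set to filter. *)
pose d := (\sum_(l < n) (m0 l + 2)).+1.
pose ok (a : 'X_{1..n} * idx) :=
  [forall l, (a.1 l)%:R + 2^-1 + wt C a.2 l == lam l].
have okP a : reflect (weight_space rho lam (btens C a)) (ok a).
  apply: (iffP forallP) => [h|/(weight_btens hrho) h l]; last by rewrite h.
  by apply/(weight_btens hrho) => l; apply/eqP.
have ok_deg a : ok a -> (mdeg a.1 < d)%N.
  move=> /forallP h; rewrite ltnS mdegE; apply: leq_sum => l _.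
  have {h} h : (a.1 l)%:R + wt C a.2 l = (m0 l)%:R + wt C i0 l.
    by apply: (addIr 2^-1); rewrite addrAC (eqP (h l)) -lamE addrAC.
  rewrite -(ler_nat C) natrD -lerBlDl.
  have -> : (a.1 l)%:R - (m0 l)%:R = wt C i0 l - wt C a.2 l.
    by apply/eqP; rewrite subr_eq addrAC eq_sym subr_eq addrC h.
  rewrite /wt opprB addrACA -opprD lerBlDr.
  by rewrite -!natrD ler_nat; do 4!case: eqP.
pose all_a := [seq (bmnm x.1, x.2) | x <- enum [set: 'X_{1..n < d} * idx]].
have all_aP a : ok a -> a \in all_a.
  move=> oka; apply/mapP; exists (BMultinom (ok_deg a oka), a.2) => //=.
    by rewrite mem_enum inE.
  exact: surjective_pairing.
pose s := [seq a <- all_a | ok a].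
have memP a : a \in s <-> weight_space rho lam (btens C a).
  rewrite mem_filter; split=> [/andP[/okP]//|/okP oka].
  by rewrite oka all_aP.
have us : uniq s.
  rewrite filter_uniq // map_inj_uniq ?enum_uniq //.
  move=> [k i] [k' i'] /= [ek ->].
  by congr pair; apply/eqP; rewrite bmeqP ek.
pose z (a : 'X_{1..n} * idx) := a.2 == izero n.
have perm_t : perm_eq ([seq a <- s | z a] ++ [seq a <- s | predC z a]) s.
  by rewrite perm_filterC.
exists ([seq a <- s | z a] ++ [seq a <- s | predC z a]); split.
- by rewrite (perm_uniq perm_t).
- by move=> a; rewrite (perm_mem perm_t).
move=> a; rewrite (perm_mem perm_t) => sa a0.
(* The list starts with the tensors having second factor v_0. By [weight_basis_inj] its head must be
   [a]. *)
have za : a \in [seq a <- s | z a] by rewrite mem_filter sa /z a0 eqxx.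
case def_t: [seq a <- s | z a] za => [//|b t] _.
have : b \in [seq a <- s | z a] by rewrite def_t mem_head.
rewrite mem_filter => /andP[/eqP b0 sb].
rewrite (weight_basis_inj (proj1 (memP _) sa) (proj1 (memP _) sb)) ?a0 ?b0 //.
by rewrite /= eqxx.
Qed.

Definition shear (N : V -> V) (u : V) : V := u + N u.

Lemma shear_linear (N : {linear V -> V}) : linear (shear N).
Proof. by move=> a u v; rewrite /shear linearP scalerDr addrACA. Qed.
HB.instance Definition _ (N : {linear V -> V}) :=
  GRing.isLinear.Build C V V *:%R (shear N) (shear_linear N).

Lemma matrix_of_shear (N : V -> V) a b :
  matrix_of (shear N) a b = (a == b)%:R + matrix_of N a b.
Proof.
rewrite /matrix_of /shear ffunE mcoeffD mcoeff_btens -surjective_pairing.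
by rewrite eq_sym.
Qed.

Section SquareZero.
Variable N : {linear V -> V}.
Hypothesis NN : forall u, N (N u) = 0.

Lemma shearK : cancel (shear N) (fun u => u - N u).
Proof. by move=> u; rewrite /shear linearD /= NN addr0 addrK. Qed.

Lemma shearVK : cancel (fun u => u - N u) (shear N).
Proof. by move=> u; rewrite /shear linearB /= NN subr0 subrK. Qed.

Lemma shear_super_automorphism :
  (forall p u, Vpar p u -> Vpar p (N u)) -> super_automorphism (shear N).
Proof.
move=> Npar; split; first exact: Bijective shearK shearVK.
by move=> p u pu i; rewrite ffunE; apply: polyparD; [exact: pu | exact: Npar].
Qed.

Hypothesis Nwt :
  forall lam u, weight_space rho lam u -> weight_space rho lam (N u).

Lemma shear_weight lam u :
  weight_space rho lam u -> weight_space rho lam (shear N u).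
Proof. by move=> wu; apply: weight_spaceD => //; exact: Nwt. Qed.

(** The inverse id - N preserves weights as well. *)
Lemma shear_restricts lam : restricts_to_automorphism rho (shear N) lam.
Proof.
split=> [u|w ww]; first exact: shear_weight.
exists (w - N w); split=> [|u [_ <-]]; last by rewrite shearK.
by split; [apply/weight_spaceD/weight_spaceN/Nwt | rewrite shearVK].
Qed.

Lemma shear_block_diagonal : block_diagonal rho (shear N).
Proof.
move=> lam a b /shear_weight/(weight_spaceP hrho) wb nz.
by apply/(weight_btens hrho) => l; apply: wb.
Qed.

(** Only position 0 can carry v_0. As [N] has no entries within the v_0-part or within its
    complement, the diagonal is 1 and all other nonzero entries lie in the first row or first
    column. [Nrow] leaves only one of these, so the block is triangular of determinant 1. *)
Lemma shear_block lam :
    (forall a b, (a.2 == izero n) = (b.2 == izero n) -> matrix_of N a b = 0) ->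
    (forall a b, a.2 != izero n -> matrix_of N a b = 0) \/
    (forall a b, b.2 != izero n -> matrix_of N a b = 0) ->
  is_weight rho lam -> invertible_arrowhead_block rho (shear N) lam.
Proof.
move=> Ndiag Nrow /ordered_basis_exists exs; split=> // s [us ws s0].
have tnthK (i : 'I_(size s)) : index (tnth (in_tuple s) i) s = i.
  have x0 := tnth (in_tuple s) i.
  by rewrite (tnth_nth x0) /= index_uniq.
have nz (i : 'I_(size s)) :
    i != 0%N :> nat -> (tnth (in_tuple s) i).2 != izero n.
  by apply: contra => /eqP/s0; rewrite tnthK => ->; rewrite ?mem_tnth.
have neq (i j : 'I_(size s)) :
    i != j -> (tnth (in_tuple s) i == tnth (in_tuple s) j) = false.
  move=> ij; have x0 := tnth (in_tuple s) i.
  by rewrite !(tnth_nth x0) /= nth_uniq //; apply: negbTE.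
split.
  move=> i j /nz i0 /nz j0 ij; rewrite mxE matrix_of_shear neq // add0r.
  by apply: Ndiag; rewrite (negPf i0) (negPf j0).
have diag i : matrix_block (shear N) s i i = 1.
  by rewrite mxE matrix_of_shear eqxx Ndiag ?addr0.
have lt_nz (i j : 'I_(size s)) :
    (i < j)%N -> (tnth (in_tuple s) j).2 != izero n /\ i != j.
  move=> ij; split; last by apply: contraTneq ij => ->; rewrite ltnn.
  by apply: nz; rewrite -lt0n (leq_ltn_trans _ ij).
(* [det_trig] is about lower triangular matrices. The first alternative leaves only the first row,
   so it is transposed. *)
rewrite unitmxE; case: Nrow => N0; [rewrite -det_tr|]; rewrite det_trig.
- by rewrite big1 ?unitr1 // => i _; rewrite mxE.
- apply/is_trig_mxP => i j /lt_nz[j0 ij]; rewrite 2!mxE matrix_of_shear.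
  by rewrite eq_sym neq // N0 // addr0.
- by rewrite big1 ?unitr1.
- apply/is_trig_mxP => i j /lt_nz[j0 ij]; rewrite mxE matrix_of_shear.
  by rewrite neq // N0 // addr0.
Qed.

End SquareZero.
End Shear.

(** * The two square-zero maps, and the submodules cut out by their graphs *)

Section Splitting.
Variables (C : numClosedFieldType) (n : nat).
Local Notation P := {mpoly C[n]}.
Local Notation idx := 'I_(1 + (n + n)).
Local Notation V := {ffun idx -> P}.
Local Notation mx := 'M[C]_(1 + (n + n)).
Variables (rho : mx -> P -> P) (hrho : is_oscillator rho).

Lemma V_ext (u v : V) : u (izero n) = v (izero n) ->
  (forall k, u (rshift 1 k) = v (rshift 1 k)) -> u = v.
Proof. by move=> eq0 eqk; apply/ffunP; apply: idx_ind. Qed.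

(* Both operators are locked because a failed unification of their values at
   two different vectors would otherwise unfold them forever. *)
Definition spread : V -> V := locked (fun u =>
  [ffun i => if split i is inr k
             then 2 *: oscD k (psign (u (izero n))) else 0 : P]).

Definition gather : V -> V := locked (fun u =>
  [ffun i => if i == izero n
             then 2 *: \sum_k oscB k (psign (u (rshift 1 k))) else 0]).

Lemma spread_izero u : spread u (izero n) = 0.
Proof.
by rewrite /spread -lock ffunE -[izero n]/(unsplit (inl ord0)) unsplitK.
Qed.

Lemma spread_rshift u k :
  spread u (rshift 1 k) = 2 *: oscD k (psign (u (izero n))).
Proof.
by rewrite /spread -lock ffunE -[rshift 1 k]/(unsplit (inr k)) unsplitK.
Qed.

Lemma gather_izero u :
  gather u (izero n) = 2 *: \sum_k oscB k (psign (u (rshift 1 k))).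
Proof. by rewrite /gather -lock ffunE eqxx. Qed.

Lemma gather_rshift u k : gather u (rshift 1 k) = 0.
Proof. by rewrite /gather -lock ffunE rshift_neq_izero. Qed.

Lemma ffun_linear a (u v : V) i : (a *: u + v) i = a *: u i + v i.
Proof. by rewrite !ffunE. Qed.

Lemma spread_linear : linear spread.
Proof.
move=> a u v; apply: V_ext => [|k]; rewrite ffun_linear.
  by rewrite !spread_izero scaler0 addr0.
rewrite !spread_rshift ffun_linear [psign _]linearP linearP /=.
by rewrite scalerDr !scalerA mulrC.
Qed.
HB.instance Definition _ :=
  GRing.isLinear.Build C V V *:%R spread spread_linear.

Lemma gather_linear : linear gather.
Proof.
move=> a u v; apply: V_ext => [|k]; rewrite ffun_linear.
  rewrite !gather_izero scalerA [a * 2]mulrC -scalerA -scalerDr; congr (_ *: _).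
  rewrite scaler_sumr -big_split; apply: eq_bigr => k _ /=.
  by rewrite ffun_linear [psign _]linearP linearP.
by rewrite !gather_rshift scaler0 addr0.
Qed.
HB.instance Definition _ :=
  GRing.isLinear.Build C V V *:%R gather gather_linear.

Lemma spread_sq0 u : spread (spread u) = 0.
Proof.
apply: V_ext => [|k]; rewrite ?spread_izero ?spread_rshift ffunE //.
by rewrite spread_izero [psign _]linear0 linear0 scaler0.
Qed.

Lemma gather_sq0 u : gather (gather u) = 0.
Proof.
apply: V_ext => [|k]; rewrite ?gather_izero ?gather_rshift ffunE //.
rewrite big1 ?scaler0 // => k _.
by rewrite gather_rshift [psign _]linear0 linear0.
Qed.

Lemma spread_par p u : Vpar p u -> Vpar p (spread u).
Proof.
move=> pu; apply: idx_ind => [|k]; rewrite ?spread_izero ?spread_rshift.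
  exact: polypar0.
rewrite /vpar rshift_neq_izero addbT; apply/polyparZ/oscD_par/polypar_psign.
by have := pu (izero n); rewrite /vpar eqxx addbF.
Qed.

Lemma gather_par p u : Vpar p u -> Vpar p (gather u).
Proof.
move=> pu; apply: idx_ind => [|k]; rewrite ?gather_izero ?gather_rshift;
  last first.
  exact: polypar0.
rewrite /vpar eqxx addbF; apply/polyparZ/polypar_sum => k; rewrite -[p]negbK.
apply/oscB_par/polypar_psign.
by have := pu (rshift 1 k); rewrite /vpar rshift_neq_izero addbT.
Qed.

Lemma spread_weight lam u :
  weight_space rho lam u -> weight_space rho lam (spread u).
Proof.
move=> /(weight_spaceP hrho) wu; apply/(weight_spaceP hrho).
apply: idx_ind => [|k] m; first by rewrite spread_izero mcoeff0 eqxx.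
rewrite spread_rshift mcoeffZ mulf_eq0 negb_or => /andP[_].
case/mcoeff_oscD_neq0 => m'; rewrite mcoeff_psign mulf_eq0 negb_or.
move=> /andP[_ /wu wm'] mE l.
by rewrite addrAC mE -(wm' l) wt_izero addr0.
Qed.

Lemma gather_weight lam u :
  weight_space rho lam u -> weight_space rho lam (gather u).
Proof.
move=> /(weight_spaceP hrho) wu; apply/(weight_spaceP hrho).
apply: idx_ind => [|k] m; last by rewrite gather_rshift mcoeff0 eqxx.
rewrite gather_izero mcoeffZ mulf_eq0 negb_or => /andP[_].
elim/big_rec: _ => [|k f _ IH]; first by rewrite mcoeff0 eqxx.
rewrite mcoeffD.
have [->|nz _] := eqVneq (oscB k (psign (u (rshift 1 k))))@_m 0.
  by rewrite add0r.
have [m'] := mcoeff_oscB_neq0 nz; rewrite mcoeff_psign mulf_eq0 negb_or.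
move=> /andP[_ /wu wm'] mE l.
by rewrite wt_izero addr0 -mE addrAC.
Qed.

Lemma btens_eq0 (a : 'X_{1..n} * idx) i : a.2 != i -> btens C a i = 0.
Proof. by move=> ai; rewrite ffunE mxE eq_sym (negPf ai) scale0r. Qed.

Lemma matrix_spread_l a b : a.2 == izero n -> matrix_of spread a b = 0.
Proof. by move=> /eqP a0; rewrite /matrix_of a0 spread_izero mcoeff0. Qed.

Lemma matrix_spread_r a b : b.2 != izero n -> matrix_of spread a b = 0.
Proof.
move=> b0; rewrite /matrix_of; elim/idx_ind: a.2 => [|k].
  by rewrite spread_izero mcoeff0.
by rewrite spread_rshift btens_eq0 // [psign _]linear0 linear0 scaler0 mcoeff0.
Qed.

Lemma matrix_gather_l a b : a.2 != izero n -> matrix_of gather a b = 0.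
Proof.
rewrite /matrix_of; elim/idx_ind: a.2 => [|k _]; first by rewrite eqxx.
by rewrite gather_rshift mcoeff0.
Qed.

Lemma matrix_gather_r a b : b.2 == izero n -> matrix_of gather a b = 0.
Proof.
move=> /eqP b0; rewrite /matrix_of; elim/idx_ind: a.2 => [|k]; last first.
  by rewrite gather_rshift mcoeff0.
rewrite gather_izero big1 ?scaler0 ?mcoeff0 // => k _.
by rewrite btens_eq0 ?[psign _]linear0 ?linear0 // b0 eq_sym rshift_neq_izero.
Qed.

Lemma shear_spread_block lam :
  is_weight rho lam -> invertible_arrowhead_block rho (shear spread) lam.
Proof.
apply: (shear_block hrho); last by right; exact: matrix_spread_r.
move=> a b; case: eqP => [/eqP a0 _|_ /esym/negbT b0].
  exact: matrix_spread_l.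
exact: matrix_spread_r.
Qed.

Lemma shear_gather_block lam :
  is_weight rho lam -> invertible_arrowhead_block rho (shear gather) lam.
Proof.
apply: (shear_block hrho); last by left; exact: matrix_gather_l.
move=> a b; case: eqP => [_ /esym b0|/eqP a0 _].
  exact: matrix_gather_r.
exact: matrix_gather_l.
Qed.

(** The shear keeps the v_0-component and fills in the others from it, so the image is a graph. The
    preimage of [w] is its v_0-part. *)
Lemma image_spreadP w : image_of (shear spread) (@V10 C n) w <->
  forall k, w (rshift 1 k) = 2 *: oscD k (psign (w (izero n))).
Proof.
split=> [[u u0 ->] k|wE].
  rewrite ffunE u0 ?add0r; last by rewrite /vpar rshift_neq_izero.
  by rewrite spread_rshift ffunE spread_izero addr0.
exists [ffun i => if i == izero n then w i else 0] => [i /negPf i0|].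
  by rewrite ffunE i0.
apply: V_ext => [|k]; rewrite ffunE.
  by rewrite spread_izero addr0 ffunE eqxx.
by rewrite spread_rshift !ffunE rshift_neq_izero eqxx add0r.
Qed.

Lemma image_gatherP w : image_of (shear gather) (@V02n C n) w <->
  w (izero n) = 2 *: \sum_k oscB k (psign (w (rshift 1 k))).
Proof.
split=> [[u u0 ->]|wE].
  rewrite ffunE u0 add0r gather_izero; apply/(congr1 ( *:%R 2))/eq_bigr => k _.
  by rewrite ffunE gather_rshift addr0.
exists [ffun i => if i == izero n then 0 else w i].
  by rewrite /V02n ffunE eqxx.
apply: V_ext => [|k]; rewrite ffunE.
  rewrite gather_izero ffunE eqxx add0r wE.
  apply/(congr1 ( *:%R 2))/eq_bigr => k _.
  by rewrite ffunE rshift_neq_izero.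
by rewrite gather_rshift addr0 ffunE rshift_neq_izero.
Qed.

Lemma parity_op_izero (u : V) : parity_op u (izero n) = psign (u (izero n)).
Proof. by rewrite ffunE /vpar eqxx expr0 scale1r. Qed.

Lemma parity_op_rshift (u : V) k :
  parity_op u (rshift 1 k) = - psign (u (rshift 1 k)).
Proof. by rewrite ffunE /vpar rshift_neq_izero expr1 scaleN1r. Qed.

(** The graph equation is preserved by odd elements because of the commutator [oscDL]. The factor 2
    in [spread] offsets the 1/2 in that commutator. *)
Lemma spread_submodule :
  osp_submodule rho (image_of (shear spread) (@V10 C n)).
Proof.
apply: (osp_submoduleP hrho).
- by apply/image_spreadP => k; rewrite !ffunE [psign _]linear0 linear0 scaler0.
- move=> a u v /image_spreadP uE /image_spreadP vE; apply/image_spreadP => k.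
  rewrite !ffun_linear uE vE [psign (_ + _)]linearP linearP /= scalerDr.
  by rewrite !scalerA mulrC.
- move=> u /image_spreadP uE; apply/image_spreadP => k.
  rewrite parity_op_rshift parity_op_izero uE [psign (_ *: _)]linearZ /=.
  by rewrite psign_oscD scalerN opprK.
- move=> r u /image_spreadP uE; apply/image_spreadP => k.
  rewrite (tact_oddmx_zero hrho) (tact_oddmx_rshift hrho) uE.
  set f := psign (u (izero n)).
  (* The v_0-component of the image: the first term gives minus [oscL r f], and the graph equation
     turns the sum into twice [oscL r f]. *)
  have -> : psign (oscL r (u (izero n))
      + \sum_k r 0 k *: psign (u (rshift 1 k))) = oscL r f.
    rewrite [LHS]linearD /= psign_oscL -/f [psign (\sum_(k < _) _)]linear_sum.
    rewrite (eq_bigr (fun k => 2 *: (r 0 k *: oscD k f))); last first.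
      move=> l _; rewrite [LHS]linearZ /= psignK uE -/f !scalerA.
      by rewrite mulrC.
    by rewrite -scaler_sumr -/(oscL r f) scaler_nat mulr2n addKr.
  by rewrite oscDL linearZ /= scalerDr scalerA mulrC divfK ?pnatr_eq0.
Qed.

(** Dual to [spread_submodule], with the commutator [oscLBcomm] instead of [oscDL]. *)
Lemma gather_submodule :
  osp_submodule rho (image_of (shear gather) (@V02n C n)).
Proof.
apply: (osp_submoduleP hrho).
- apply/image_gatherP; rewrite ffunE big1 ?scaler0 // => k _.
  by rewrite ffunE [psign _]linear0 linear0.
- move=> a u v /image_gatherP uE /image_gatherP vE; apply/image_gatherP.
  rewrite ffun_linear uE vE scalerA mulrC -scalerA -scalerDr; congr (_ *: _).
  rewrite scaler_sumr -big_split; apply: eq_bigr => k _ /=.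
  by rewrite ffun_linear [psign (_ + _)]linearP linearP.
- move=> u /image_gatherP uE; apply/image_gatherP.
  rewrite parity_op_izero uE [psign _]linearZ /= [psign _]linear_sum.
  congr (_ *: _); apply: eq_bigr => k _ /=.
  by rewrite parity_op_rshift psign_oscB [psign (- _)]linearN linearN.
- move=> r u /image_gatherP uE; apply/image_gatherP.
  rewrite (tact_oddmx_zero hrho).
  (* After summing and doubling, the first term is minus [oscL r] of the v_0-component by the graph
     equation. The last is twice the same by [oscLB], and the middle one is the sum over odd
     components required by the action. *)
  rewrite [X in _ = 2 *: X](eq_bigr (fun k =>
    - (oscL r (oscB k (psign (u (rshift 1 k)))))
    + (r 0 k / 2) *: psign (u (rshift 1 k))
    + osp_col r k 0 *: oscB k (u (izero n)))); last first.
    move=> k _; rewrite (tact_oddmx_rshift hrho) oscLBcomm opprD addrNK.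
    rewrite [psign _]linearD /= psign_oscL [psign (_ *: _)]linearZ /= psignK.
    by rewrite linearD linearN linearZ.
  rewrite big_split big_split /= -oscLB sumrN -[\sum_k oscL _ _]linear_sum /=.
  rewrite !scalerDr scalerN -[2 *: oscL r (\sum_k _)]linearZ -uE.
  rewrite scaler_sumr addrAC; congr (_ + _).
    by rewrite scaler_nat mulr2n addKr.
  by apply: eq_bigr => k _; rewrite scalerA mulrC divfK ?pnatr_eq0.
Qed.

End Splitting.

Theorem theorem1p2 (R : realType) (n : nat) (hn : (1 <= n)%N)
    (rho : 'M[R[i]]_(1 + (n + n)) -> {mpoly R[i][n]} -> {mpoly R[i][n]})
    (hrho : is_oscillator rho) :
  exists G1 G2 : {linear {ffun 'I_(1 + (n + n)) -> {mpoly R[i][n]}} ->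
                         {ffun 'I_(1 + (n + n)) -> {mpoly R[i][n]}}},
    (super_automorphism G1 /\ super_automorphism G2) /\
    [/\ osp_submodule rho (image_of G2 (@V10 R[i] n)),
        osp_submodule rho (image_of G1 (@V02n R[i] n)),
        (forall lam, is_weight rho lam ->
           restricts_to_automorphism rho G1 lam /\
           invertible_arrowhead_block rho G1 lam) /\
        block_diagonal rho G1
      & (forall lam, is_weight rho lam ->
           restricts_to_automorphism rho G2 lam /\
           invertible_arrowhead_block rho G2 lam) /\
        block_diagonal rho G2].
Proof.
have Gwt := gather_weight hrho; have Swt := spread_weight hrho.
exists (shear (@gather R[i] n)), (shear (@spread R[i] n)); split.
  split; apply: shear_super_automorphism.
  - exact: gather_sq0.
  - exact: gather_par.
  - exact: spread_sq0.
  - exact: spread_par.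
split; [exact: spread_submodule | exact: gather_submodule | split | split].
- move=> lam wlam; split; last exact: shear_gather_block.
  exact: (shear_restricts hrho (@gather_sq0 _ n) Gwt).
- exact: (shear_block_diagonal hrho Gwt).
- move=> lam wlam; split; last exact: shear_spread_block.
  exact: (shear_restricts hrho (@spread_sq0 _ n) Swt).
- exact: (shear_block_diagonal hrho Swt).
Qed.
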